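(* Let $\lambda=(n-1,1)$ and fix $\varepsilon>0$. If $f$ is generated by the random model $R(K,\mathcal C)$ with $K\le(1-\varepsilon)n\log n$, then with probability $1-o(1)$ as $n\to\infty$ the sparsest-fit algorithm applied to $\hat f(\lambda)$ recovers $f$.
   Context: $\log$ is the natural logarithm. $S_n$ is the symmetric group on $\{1,\dots,n\}$. For a partition $\lambda=(\lambda_1,\dots,\lambda_r)$ of $n$ ($\lambda_1\ge\dots\ge\lambda_r\ge1$), a $\lambda$-partition of $\{1,\dots,n\}$ is an ordered tuple $(B_1,\dots,B_r)$ of disjoint sets with $|B_i|=\lambda_i$ and union $\{1,\dots,n\}$; there are $D_\lambda=n!/\prod_i\lambda_i!$ of them, enumerated $t_1,\dots,t_{D_\lambda}$; $\sigma$ acts by $\sigma(B_1,\dots,B_r)=(\sigma(B_1),\dots,\sigma(B_r))$. $M^\lambda(\sigma)$ is the $D_\lambda\times D_\lambda$ $0/1$ matrix with $M^\lambda_{ij}(\sigma)=1$ iff $\sigma(t_j)=t_i$, and $\hat f(\lambda)=\sum_\sigma f(\sigma)M^\lambda(\sigma)$. (For $\lambda=(n-1,1)$, $\hat f(\lambda)_{ij}=\sum_{k:\sigma_k(j)=i}f(\sigma_k)$.) Random model $R(K,\mathcal C)$: for fixed $\mathcal C=[a,b]$, $0<a<b$, choose $\sigma_1,\dots,\sigma_K$ i.i.d. uniform from $S_n$ (with replacement) and $p_1,\dots,p_K$ i.i.d. uniform on $\mathcal C$; $f(\sigma)=p_i$ if $\sigma=\sigma_i$, else $0$. Sparsest-fit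 algorithm: input the nonzero entries $q_1\le\dots\le q_L$ of $\hat f(\lambda)$ sorted ascending (with their matrix positions). Initialize $p_0=0$, $k(0)=0$, all $A_k=\emptyset$. For $\ell=1,\dots,L$: if $q_\ell=\sum_{k\in T}p_k$ for some $T\subseteq\{0,\dots,k(\ell-1)\}$, set $k(\ell)=k(\ell-1)$ and add $\ell$ to $A_k$ for $k\in T$; else set $k(\ell)=k(\ell-1)+1$, $p_{k(\ell)}=q_\ell$, add $\ell$ to $A_{k(\ell)}$. Output $(p_k,A_k)_{1\le k\le k(L)}$; each $A_k$ (a set of matrix positions) is read as the support of $M^\lambda(\sigma_k)$, giving a permutation $\sigma_k$ with value $p_k$. ''Recovers $f$'' means the resulting function equals $f$. *)

(* Defs.v *)
From HB Require Import structures.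
From mathcomp Require Import all_boot all_order all_algebra all_fingroup.
From mathcomp Require Import all_classical all_reals all_analysis.
Set Implicit Arguments.
Unset Strict Implicit.
Unset Printing Implicit Defensive.
Import Order.TTheory GRing.Theory Num.Theory.
Local Open Scope ring_scope.

Section SparsestFit.
Variable R : realType.
Variable n : nat.

Definition pos := ('I_n * 'I_n)%type.

(* For lambda = (n-1,1), the lambda-partition t_j is identified with the
   index j of its singleton block, so M^lambda(sigma)_{ij} = 1 iff
   sigma(t_j) = t_i iff sigma j = i.  The support of M^lambda(sigma): *)
Definition Msupp (s : {perm 'I_n}) : {set pos} := [set (s j, j) | j : 'I_n].

Definition fhat (f : {perm 'I_n} -> R) : 'M[R]_n :=
  \matrix_(i, j) \sum_(s : {perm 'I_n}) (if s j == i then f s else 0).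

Definition nz_entries (M : 'M[R]_n) : seq (R * pos) :=
  [seq (M x.1 x.2, x) | x <- enum {: pos} & M x.1 x.2 != 0].

Definition sorted_input (M : 'M[R]_n) (s : seq (R * pos)) : Prop :=
  perm_eq s (nz_entries M) /\ sorted (fun u v => u.1 <= v.1) s.

(* Algorithm state: the list [(p_1, A_1); ...; (p_k, A_k)]  (p_0 = 0 is
   implicit: it never changes a sum and A_0 is not part of the output).
   A subset T of {1..k} is encoded by a mask m of size k. *)
Definition state := seq (R * {set pos}).

Definition add_pos (x : pos) (m : bitseq) (st : state) : state :=
  map (fun bp => if bp.1 then (bp.2.1, x |: bp.2.2) else bp.2) (zip m st).

Inductive sf_run : seq (R * pos) -> state -> state -> Prop :=
| sf_nil st : sf_run [::] st st
| sf_match q x s st m out :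
    size m = size st ->
    q = \sum_(y <- mask m st) y.1 ->
    sf_run s (add_pos x m st) out ->
    sf_run ((q, x) :: s) st out
| sf_new q x s st out :
    (forall m : bitseq, size m = size st -> q <> \sum_(y <- mask m st) y.1) ->
    sf_run s (rcons st (q, [set x])) out ->
    sf_run ((q, x) :: s) st out.

Definition recovers (out : state) (f : {perm 'I_n} -> R) : Prop :=
  (forall y, y \in out -> exists s : {perm 'I_n}, y.2 = Msupp s) /\
  forall s : {perm 'I_n}, f s = \sum_(y <- out | y.2 == Msupp s) y.1.

(* The sparsest-fit algorithm applied to hat f(lambda) recovers f
   (whatever the order of ties and the choices of T). *)
Definition sf_recovers (f : {perm 'I_n} -> R) : Prop :=
  forall s out, sorted_input (fhat f) s -> sf_run s [::] out -> recovers out f.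

(* The function of the random model R(K, C): f(sigma) = p_i if sigma = sigma_i
   (values added up in the null event of a collision sigma_i = sigma_j). *)
Definition model_fun (K : nat) (ss : {ffun 'I_K -> {perm 'I_n}}) (ps : seq R)
  (s : {perm 'I_n}) : R :=
  \sum_(i < K | ss i == s) nth 0 ps i.

End SparsestFit.

Section Probability.
Local Open Scope ereal_scope.
Variable R : realType.

(* Expectation of g(p_1,...,p_k) for p_1,...,p_k i.i.d. uniform on [a,b]
   (iterated Lebesgue integrals with the uniform density 1/(b-a)). *)
Fixpoint unif_iter (a b : R) (k : nat) (g : seq R -> \bar R) : \bar R :=
  match k with
  | 0 => g [::]
  | k'.+1 => \int[@lebesgue_measure R]_(x in `[a, b]%classic)
               (((b - a)^-1)%:E * unif_iter a b k' (fun s => g (x :: s)))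
  end.

Definition recovery_prob (a b : R) (n K : nat) : \bar R :=
  \sum_(ss : {ffun 'I_K -> {perm 'I_n}})
    ((#|{: {ffun 'I_K -> {perm 'I_n}}}|%:R)^-1)%:E *
    unif_iter a b K (fun ps =>
      (if `[< sf_recovers (model_fun ss ps) >] then 1 else 0)).

End Probability.

(* Main.v *)
(* If the subset sums of p_1, ..., p_K are pairwise distinct and every sigma_k
   has a witness, i.e. a column j with sigma_l(j) <> sigma_k(j) for all l <> k,
   then the algorithm succeeds: the value p_k occurs as an entry, and it is read
   before every larger entry sigma_k contributes to, so each entry is either a
   new p_k or a known subset sum in exactly one way.

   The subset sums are almost surely distinct, since given p_1, ..., p_k only
   finitely many values of p_(k+1) create a coincidence.

   For the witnesses, reveal the first L columns one at a time. Given the past,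
   column m is no witness for sigma_i with probability at most
   1 - (1 - 1/(n - m))^K, so sigma_i has no witness with probability at most
   (1 - (1 - 1/(n - L))^K)^L. With L ~ (eps/4) n and K <= (1 - eps) n log n this
   is at most exp(- c n^(eps/4)), which survives a union bound over i. *)
Require Import Defs.
From HB Require Import structures.
From mathcomp Require Import all_boot all_order all_algebra all_fingroup.
From mathcomp Require Import all_classical all_reals all_analysis.
From mathcomp Require Import ring lra.
Set Implicit Arguments.
Unset Strict Implicit.
Unset Printing Implicit Defensive.
Import Order.TTheory GRing.Theory Num.Theory.
Local Open Scope ring_scope.

(** * Correctness of the algorithm *)

Lemma mem_Msupp (n : nat) (s : {perm 'I_n}) (x : pos n) :
  (x \in Msupp s) = (s x.2 == x.1).
Proof.
case: x => i j /=; apply/imsetP/eqP => [[k _ [-> ->]] //|<-].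
by exists j.
Qed.

Lemma Msupp_inj (n : nat) : injective (@Msupp n).
Proof.
move=> s t st; apply/permP => j.
have : (s j, j) \in Msupp t by rewrite -st mem_Msupp.
by rewrite mem_Msupp /= => /eqP.
Qed.

(** Uniqueness of [s] turns the places selected by [m] into membership in [mask m s], so that the
    positional update [add_pos] can be read element by element. *)
Lemma map_zip_mask (T : eqType) (S S' : Type) (F G : S -> S') (h : T -> S)
    (m : bitseq) (s : seq T) : uniq s -> size m = size s ->
  [seq if bx.1 then F bx.2 else G bx.2 | bx <- zip m (map h s)] =
  [seq if x \in mask m s then F (h x) else G (h x) | x <- s].
Proof.
elim: s m => [|x s IH] [|b m] //= /andP[xs us] [sm].
rewrite IH//; congr cons.
  case: b => /=; first by rewrite inE eqxx.
  by case: ifP => // /mem_mask; rewrite (negbTE xs).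
apply/eq_in_map => y ys.
by case: b => //=; rewrite inE; case: eqVneq => // yx; rewrite -yx ys in xs.
Qed.

Section Correctness.
Variables (R : realType) (n K : nat) (ss : {ffun 'I_K -> {perm 'I_n}}).
Variable p : 'I_K -> R.
Hypothesis p_gt0 : forall k, 0 < p k.
Hypothesis subset_sum_inj : forall T T' : {set 'I_K},
  \sum_(k in T) p k = \sum_(k in T') p k -> T = T'.
Hypothesis witness : forall k, exists j, forall l, ss l j = ss k j -> l = k.

Let f (s : {perm 'I_n}) : R := \sum_(k | ss k == s) p k.

Let users (x : pos n) : {set 'I_K} := [set k | ss k x.2 == x.1].

Let value (x : pos n) : R := \sum_(k in users x) p k.

Lemma fhat_model (x : pos n) : fhat f x.1 x.2 = value x.
Proof.
rewrite mxE -big_mkcond /= /f (exchange_big_dep predT)//= /value.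
rewrite [RHS]big_mkcond; apply: eq_bigr => k _; rewrite inE.
rewrite (eq_bigl (fun s => (s == ss k) && (ss k x.2 == x.1))); last first.
  by move=> s; rewrite andbC eq_sym; case: eqP => // ->.
case: ifP => h; last by rewrite big_pred0// => s; rewrite andbF.
by rewrite (eq_bigl (pred1 (ss k))) ?big_pred1_eq// => s; rewrite andbT.
Qed.

Lemma value_eq0 (x : pos n) : (value x == 0) = (users x == finset.set0).
Proof.
apply/eqP/eqP => [v0|]; last by rewrite /value => ->; rewrite big_set0.
by apply: subset_sum_inj; rewrite big_set0.
Qed.

Lemma value_ge (x : pos n) k : k \in users x -> p k <= value x.
Proof.
move=> kx; rewrite /value (bigD1 k)//= lerDl sumr_ge0// => i _.
exact: ltW.
Qed.

(** The expected state once the positions in [P] have been read; [ks] lists the indices found so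
    far, in order of discovery. *)
Let discovered (P : {set pos n}) (ks : seq 'I_K) : state R n :=
  [seq (p k, [set y in P | k \in users y]) | k <- ks].

Lemma mask_discovered P ks (m : bitseq) : uniq ks ->
  \sum_(y <- mask m (discovered P ks)) y.1 =
  \sum_(k in [set k in mask m ks]) p k.
Proof.
move=> uks; rewrite -map_mask big_map big_uniq ?mask_uniq//=.
by apply: eq_bigl => k; rewrite inE.
Qed.

(** Induction on the run. Invariant: the state is [discovered P ks], all users of positions in [P]
    are in [ks], and each used position outside [P] is still in the input. *)
Lemma sf_run_discovers (s : seq (R * pos n)) (st out : state R n) :
  sf_run s st out ->
  forall (P : {set pos n}) (ks : seq 'I_K),
  st = discovered P ks -> uniq ks ->
  (forall y k, y \in P -> k \in users y -> k \in ks) ->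
  (forall e, e \in s -> e.1 = value e.2) ->
  (forall y, users y != finset.set0 -> y \notin P -> (value y, y) \in s) ->
  sorted (fun u v => u.1 <= v.1) s ->
  exists2 ks', uniq ks' &
    (forall k, k \in ks') /\
    out = [seq (p k, Msupp (ss k)) | k <- ks'].
Proof.
have letr : transitive (fun u v : R * pos n => u.1 <= v.1).
  by move=> u v w; apply: le_trans.
(* An undiscovered user of the current entry [x] must be its only user: the
   unique witness of a user [k] carries the value [p k], which is read before
   any larger value. *)
have single (P : {set pos n}) (ks : seq 'I_K) q x s' : (forall y k, y \in P -> k \in users y -> k \in ks) ->
    (forall e, e \in (q, x) :: s' -> e.1 = value e.2) ->
    (forall y, users y != finset.set0 -> y \notin P ->
       (value y, y) \in (q, x) :: s') ->
    sorted (fun u v => u.1 <= v.1) ((q, x) :: s') ->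
    forall k, k \in users x -> k \notin ks -> users x = [set k].
  move=> hP hv hs; rewrite /= path_sortedE// => /andP[/allP hq _] k kx kks.
  have [j jk] := witness k.
  pose w := (ss k j, j).
  have uw : users w = [set k].
    apply/setP => l; rewrite !inE /=; apply/eqP/eqP => [/jk //|-> //].
  have vw : value w = p k by rewrite /value uw big_set1.
  have qw : q <= value w.
    have /hs : users w != finset.set0 by rewrite uw -cards_eq0 cards1.
    case: (boolP (w \in P)) => [wP|_ /(_ isT)].
      by move: (hP _ k wP); rewrite uw set11 => /(_ isT); rewrite (negbTE kks).
    by rewrite inE => /orP[/eqP[-> _] //|/hq].
  have /= qx : q = value x by apply: (hv (q, x)); rewrite mem_head.
  apply: subset_sum_inj; rewrite big_set1.
  apply/eqP; rewrite eq_le; apply/andP; split; last exact: value_ge.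
  by rewrite -vw -/(value x) -qx.
elim=> {s st out} [st|q x s st m out sm qm _ IH|q x s st out noq _ IH] P ks.
(* At the end of the input every used position has been read, in particular a witness of each [k];
   hence [ks] is complete and the supports are full. *)
- move=> -> uks hP _ hs _; exists ks => //; split.
    move=> k; have [j jk] := witness k.
    apply: (hP (ss k j, j)); last by rewrite inE.
    apply/negPn/negP => /hs; rewrite in_nil => /(_ _)/notF; apply.
    by apply/set0Pn; exists k; rewrite inE.
  apply: eq_map => k; congr pair; apply/setP => y; rewrite mem_Msupp !inE.
  rewrite andb_idl// => yk; apply/negPn/negP => /hs.
  rewrite in_nil => /(_ _)/notF; apply.
  by apply/set0Pn; exists k; rewrite inE.
- move=> stE uks hP hv hs so.
  have sm' : size m = size ks by rewrite sm stE size_map.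
  (* Distinctness of the subset sums forces the matched subset to be the users of [x]. *)
  have mx : [set k in mask m ks] = users x.
    apply: subset_sum_inj; rewrite -(mask_discovered P)// -stE -qm.
    by apply: (hv (q, x)); rewrite mem_head.
  apply: (IH (x |: P) ks) => //.
  + rewrite stE /discovered /add_pos.
    rewrite (@map_zip_mask _ _ _ (fun A => (A.1, x |: A.2)) id)//.
    apply: eq_map => k.
    have -> : (k \in mask m ks) = (k \in users x) by rewrite -mx inE.
    case: ifP => kx; congr pair; apply/setP => y.
      rewrite in_setU1 [in LHS]finset.in_set [in RHS]finset.in_set in_setU1.
      by case: eqVneq => //= ->; rewrite kx.
    rewrite [in LHS]finset.in_set [in RHS]finset.in_set in_setU1.
    by case: eqVneq => //= ->; rewrite kx andbF.
  + move=> y k; rewrite in_setU1 => /orP[/eqP ->|]; last exact: hP.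
    by rewrite -mx inE; exact: mem_mask.
  + by move=> e es; apply: hv; rewrite inE es orbT.
  + move=> y y0; rewrite in_setU1 negb_or => /andP[yx /(hs _ y0)].
    by rewrite inE => /orP[/eqP[_ /eqP]|//]; rewrite (negbTE yx).
  + exact: path_sorted so.
- move=> stE uks hP hv hs so.
  have /= qx : q = value x by apply: (hv (q, x)); rewrite mem_head.
  (* If all users of [x] were known, the mask selecting them would sum to [q], against [noq]. *)
  have [k kx kks] : exists2 k, k \in users x & k \notin ks.
    apply/exists2P; apply: contrapT => /forallNP all_known.
    apply: (noq [seq k \in users x | k <- ks]); first by rewrite stE !size_map.
    rewrite stE mask_discovered// qx /value; apply: eq_bigl => k.
    rewrite inE -filter_mask mem_filter andb_idr// => kx.
    by apply: contrapT => /negP kks; apply: (all_known k).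
  have ux := single _ _ _ _ _ hP hv hs so k kx kks.
  apply: (IH (x |: P) (rcons ks k)).
  + rewrite stE /discovered map_rcons; congr rcons.
      apply/eq_in_map => l lks; congr pair; apply/setP => y.
      rewrite [in LHS]finset.in_set [in RHS]finset.in_set in_setU1.
      case: eqVneq => //= ->; suff /negbTE -> : l \notin users x.
        by rewrite andbF.
      by rewrite ux finset.in_set1; apply: contraNN kks => /eqP <-.
    congr pair; first by rewrite qx /value ux big_set1.
    apply/setP => y; rewrite finset.in_set1 finset.in_set in_setU1.
    case: eqVneq => [->|_ /=]; first by rewrite kx.
    by apply/esym/negbTE/negP => /andP[/hP/[apply]]; rewrite (negbTE kks).
  + by rewrite rcons_uniq kks.
  + move=> y l; rewrite in_setU1 mem_rcons inE => /orP[/eqP ->|yP ly].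
      by rewrite ux inE => ->.
    by rewrite (hP _ _ yP ly) orbT.
  + by move=> e es; apply: hv; rewrite inE es orbT.
  + move=> y y0; rewrite in_setU1 negb_or => /andP[yx /(hs _ y0)].
    by rewrite inE => /orP[/eqP[_ /eqP]|//]; rewrite (negbTE yx).
  + exact: path_sorted so.
Qed.

Lemma sf_recovers_model : sf_recovers f.
Proof.
move=> s out [/perm_mem ps so] run.
have ms v x : ((v, x) \in s) = (v == value x) && (users x != finset.set0).
  rewrite ps /nz_entries; apply/mapP/andP => [[y]|[/eqP -> x0]].
    by rewrite mem_filter fhat_model value_eq0 => /andP[y0 _] [-> ->].
  by exists x; rewrite ?fhat_model// mem_filter fhat_model value_eq0 x0 mem_enum.
have [ks uks [allks ->]] : exists2 ks, uniq ks & (forall k, k \in ks) /\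
    out = [seq (p k, Msupp (ss k)) | k <- ks].
  apply: (@sf_run_discovers s [::] out run finset.set0 [::]) => //.
  - by move=> y k; rewrite finset.in_set0.
  - by move=> [v x]; rewrite ms => /andP[/eqP].
  - by move=> y y0 _; rewrite ms eqxx.
split=> [y /mapP[k _ ->]|t]; first by exists (ss k).
rewrite big_map /f -[RHS]big_filter [RHS]big_uniq ?filter_uniq//=.
apply: eq_bigl => k; rewrite mem_filter allks andbT.
by rewrite (inj_eq (@Msupp_inj n)).
Qed.

End Correctness.

(** * Iterated uniform integrals *)

Section LowerIntegral.
Local Open Scope classical_set_scope.
Local Open Scope ereal_scope.
Context {d} {T : measurableType d} {R : realType}.
Variable mu : {measure set T -> \bar R}.

(* The integral of a nonnegative function is a supremum over simple functions,
   so monotonicity holds without measurability. *)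
Lemma ge0_le_integral_restrict (D E : set T) (f g : T -> \bar R) :
  (forall x, D x -> 0 <= f x) -> (forall x, E x -> 0 <= g x) ->
  (forall x, (f \_ D) x <= (g \_ E) x) ->
  \int[mu]_(x in D) f x <= \int[mu]_(x in E) g x.
Proof.
move=> f0 g0 fg; rewrite !ge0_integralE//; apply: le_ereal_sup.
by move=> _ [h hf <-]; exists h => // x; exact: le_trans (hf x) (fg x).
Qed.

Lemma ge0_le_integral_nonmeasurable (D : set T) (f g : T -> \bar R) :
  (forall x, D x -> 0 <= f x) -> (forall x, D x -> f x <= g x) ->
  \int[mu]_(x in D) f x <= \int[mu]_(x in D) g x.
Proof.
move=> f0 fg; apply: ge0_le_integral_restrict => // [x Dx|x].
  exact: le_trans (f0 _ Dx) (fg _ Dx).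
by rewrite /patch; case: ifPn => // /set_mem; exact: fg.
Qed.

End LowerIntegral.

Section UniformIteration.
Local Open Scope classical_set_scope.
Local Open Scope ereal_scope.
Context {R : realType} {a b : R}.
Hypothesis ab : (a < b)%R.

Lemma uniform_density_mass :
  ((b - a)^-1)%:E * @lebesgue_measure R `[a, b] = 1.
Proof.
rewrite lebesgue_measure_itv /= lte_fin ab -EFinD -EFinM mulVf//.
by rewrite subr_eq0 gt_eqF.
Qed.

Lemma density_ge0 : 0 <= ((b - a)^-1)%:E :> \bar R.
Proof. by rewrite lee_fin invr_ge0 subr_ge0 ltW. Qed.

Lemma unif_iter_bounds k (g : seq R -> \bar R) :
  (forall s, 0 <= g s <= 1) -> 0 <= unif_iter a b k g <= 1.
Proof.
elim: k g => [|k IH] g g01 //=.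
have IHx x := IH (fun s => g (x :: s)) (fun s => g01 (x :: s)).
apply/andP; split.
  apply: integral_ge0 => x _; apply: mule_ge0; first exact: density_ge0.
  by case/andP: (IHx x).
rewrite -uniform_density_mass -integral_cst//.
apply: ge0_le_integral_nonmeasurable => x _.
  by apply: mule_ge0; [exact: density_ge0 | case/andP: (IHx x)].
rewrite -[leRHS]mule1; apply: lee_wpmul2l; first exact: density_ge0.
by case/andP: (IHx x).
Qed.

(** [P] is a generic condition on prefixes: each good prefix has finitely many bad continuations, a
    null set for the next integral. The induction on [k] moves each integrated value into [pre]. *)
Lemma unif_iter_ae k (P : seq R -> Prop) (G : seq R -> \bar R) :
  (forall s, 0 <= G s <= 1) ->
  (forall s, P s -> finite_set [set x | ~ P (rcons s x)]) ->
  forall pre, P pre -> (forall x, x \in pre -> a <= x)%R ->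
  (forall s, size s = (size pre + k)%N -> P s ->
     (forall x, x \in s -> a <= x)%R -> G s = 1) ->
  unif_iter a b k (fun s => G (pre ++ s)) = 1.
Proof.
move=> G01 finP; elim: k => [|k IH] pre Ppre apre G1 /=.
  by rewrite cats0; apply: G1; rewrite ?addn0.
have bounds x : 0 <= unif_iter a b k (fun s => G (pre ++ x :: s)) <= 1.
  by apply: unif_iter_bounds => s; exact: G01.
have dens0 := density_ge0.
apply/eqP; rewrite eq_le; apply/andP; split.
  by case/andP: (@unif_iter_bounds k.+1 (fun s => G (pre ++ s)) (fun s => G01 _)).
pose F := [set x | ~ P (rcons pre x)].
have cF : countable F by exact/finite_set_countable/finP.
have mF : measurable (F : set (measurableTypeR R)).
  exact: (countable_measurable (@measurable_set1 R)).
have mab : measurable (`[a, b] : set (measurableTypeR R)) by [].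
(* Lower bound: the density alone already has mass 1 on [[a, b]] minus the null set [F], and off [F]
   the inner integral equals 1. *)
have <- : \int[@lebesgue_measure R]_(x in `[a, b] `\` F)
    cst (((b - a)^-1)%:E) x = 1.
  rewrite integral_cst//; last exact: measurableD.
  rewrite -uniform_density_mass; congr (_ * _).
  rewrite [RHS](_ : _ = lebesgue_measure (`[a, b] `\` F)
     + lebesgue_measure (`[a, b] `&` F)).
    rewrite (@countable_lebesgue_measure0 _ (`[a, b] `&` F)) ?adde0//.
    exact: sub_countable (subset_card_le (@subIsetr _ _ _)) cF.
  rewrite -measureU//; last 3 first.
  - exact: measurableD.
  - exact: measurableI.
  - by apply/seteqP; split => x [] // [_ ?] [].
  by rewrite setUC setUIDK.
apply: ge0_le_integral_restrict => // x.
- by move=> _; apply: mule_ge0 => //; case/andP: (bounds x).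
rewrite /patch; case: ifPn => [/set_mem [xab /contrapT Px]|_]; last first.
  by case: ifP => // _; apply: mule_ge0 => //; case/andP: (bounds x).
rewrite mem_set// (_ : unif_iter _ _ _ _ = 1) ?mule1//.
under [X in unif_iter _ _ _ X]eq_fun do rewrite -cat_rcons.
apply: IH => //.
- move=> y; rewrite mem_rcons inE => /orP[/eqP ->|]; last exact: apre.
  by move: xab; rewrite /= in_itv /= => /andP[].
- by move=> s; rewrite size_rcons addSnnS; exact: G1.
Qed.

End UniformIteration.

(** * Generic distinctness of subset sums *)

Definition distinct_subset_sums (R : zmodType) (s : seq R) : Prop :=
  forall m m' : bitseq, size m = size s -> size m' = size s ->
    \sum_(x <- mask m s) x = \sum_(x <- mask m' s) x -> m = m'.

(** A new coincidence must use [x] on exactly one side, since otherwise [x] cancels; then [x] is a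
    difference of two subset sums of [s], hence in the finite list [D]. *)
Lemma distinct_subset_sums_rcons (R : realType) (s : seq R) :
  distinct_subset_sums s ->
  finite_set [set x | ~ distinct_subset_sums (rcons s x)]%classic.
Proof.
move=> ds.
pose D := [seq \sum_(x <- mask (val mm.1) s) x - \sum_(x <- mask (val mm.2) s) x
  | mm : (size s).-tuple bool * (size s).-tuple bool].
apply: (@sub_finite_set _ _ [set` D]%classic); last exact: finite_seq.
move=> x /=; apply: contra_notP => /negP xD m m'.
have inD (u v : bitseq) : size u = size s -> size v = size s ->
    x = \sum_(x <- mask u s) x - \sum_(x <- mask v s) x -> False.
  move=> /eqP su /eqP sv xE; move/negP: xD; apply; apply/mapP.
  by exists (Tuple su, Tuple sv) => //; rewrite mem_enum.
case/lastP: m => [|m c]; case/lastP: m' => [|m' c']; rewrite ?size_rcons//.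
move=> [sm] [sm']; rewrite !mask_rcons// !big_cat /=.
case: c c' => [] [] /=; rewrite ?big_nil ?big_seq1 ?addr0.
- by move/addIr/(ds _ _ sm sm') ->.
- by move=> h; case: (inD _ _ sm' sm); rewrite -h addrAC subrr add0r.
- by move=> h; case: (inD _ _ sm sm'); rewrite h addrAC subrr add0r.
- by move/(ds _ _ sm sm') ->.
Qed.

Lemma distinct_subset_sums_set (R : realType) (K : nat) (ps : seq R)
    (T T' : {set 'I_K}) : size ps = K -> distinct_subset_sums ps ->
  \sum_(k in T) nth 0 ps k = \sum_(k in T') nth 0 ps k -> T = T'.
Proof.
move=> sps ds.
have sum_mask (A : {set 'I_K}) : \sum_(k in A) nth 0 ps k =
    \sum_(x <- mask [seq k \in A | k <- enum 'I_K] ps) x.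
  have psE : ps = [seq nth 0 ps (val k) | k <- enum 'I_K].
    rewrite (map_comp (nth 0 ps) val) val_enum_ord -sps.
    by rewrite map_nth_iota0 ?take_size.
  rewrite {2}psE -map_mask big_map -filter_mask big_filter.
  by rewrite big_enum_cond; apply: eq_bigl => k; rewrite inE.
have szm (A : {set 'I_K}) : size [seq k \in A | k <- enum 'I_K] = size ps.
  by rewrite size_map size_enum_ord.
rewrite !sum_mask => /(ds _ _ (szm T) (szm T'))/eq_in_map TT'.
by apply/setP => k; apply: TT'; rewrite mem_enum.
Qed.

(** * Counting tuples of permutations without witnesses *)

Section Covering.
Variables (n K : nat) (i : 'I_K).
Implicit Types (ss : {ffun 'I_K -> {perm 'I_n}}) (j m : 'I_n).

(** Column [j] fails to be a witness for [i]. *)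
Definition covered ss j := [exists k, (k != i) && (ss k j == ss i j)].

Definition covered_below (m : nat) : {set {ffun 'I_K -> {perm 'I_n}}} :=
  [set ss | [forall j : 'I_n, (j < m)%N ==> covered ss j]].

Lemma covered_below0 : covered_below 0 = [set: _].
Proof. by apply/setP => ss; rewrite !inE; apply/forallP. Qed.

Lemma covered_belowS m :
  covered_below m.+1 = [set ss in covered_below m | covered ss m].
Proof.
apply/setP => ss; rewrite !inE; apply/forallP/andP => [h|[/forallP h hm] j].
  split; last by have := h m; rewrite ltnS leqnn.
  by apply/forallP => j; apply/implyP => jm; have := h j; rewrite ltnS (ltnW jm).
apply/implyP; rewrite ltnS leq_eqVlt => /orP[/eqP/val_inj -> //|].
by move: (h j) => /implyP.
Qed.

(* The factor [t k >= m] moves no point below [m], hence preserves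
   [covered_below m], but redistributes the values taken at [m]. *)
Definition switch m (t : {ffun 'I_K -> 'I_n}) ss :
    {ffun 'I_K -> {perm 'I_n}} :=
  [ffun k => if k == i then ss k else (tperm m (t k) * ss k)%g].

Lemma switch_inj m t : injective (switch m t).
Proof.
move=> ss ss' /ffunP e; apply/ffunP => k; have := e k.
by rewrite !ffunE; case: ifP => // _ /mulgI.
Qed.

Lemma switch_covered_below m (t : {ffun 'I_K -> 'I_n}) ss : (forall k, m <= t k)%N ->
  ss \in covered_below m -> switch m t ss \in covered_below m.
Proof.
move=> mt; rewrite !inE => /forallP h; apply/forallP => j; apply/implyP => jm.
have /existsP[k /andP[ki ke]] := implyP (h j) jm.
apply/existsP; exists k; rewrite ki !ffunE eqxx (negbTE ki) permM tpermD//.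
  by apply: contraTneq jm => <-; rewrite ltnn.
by apply: contraTneq jm => <-; rewrite ltnNge mt.
Qed.

Lemma card_ord_ge m : #|[pred j : 'I_n | (m <= j)%N]| = (n - m)%N.
Proof.
rewrite -sum1_card -[RHS]muln1 -sum_nat_const_nat big_geq_mkord /=.
by apply: eq_bigl => j; rewrite inE.
Qed.

(** Denominator-free form of: given that the columns below [m] are covered, column [m] is uncovered
    with probability at least [(1 - 1/(n - m))^K]. Pairs [(ss, t)] with [switch m t ss] in [U] are
    counted twice: each [ss] has at least [(n - m - 1)^K] partners [t], and each [t] at most [#|U|]
    partners [ss] by injectivity of [switch m t]. *)
Lemma card_uncovered m :
  ((n - m).-1 ^ K * #|covered_below m| <=
   (n - m) ^ K * (#|covered_below m| - #|covered_below m.+1|))%N.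
Proof.
pose U := [set ss in covered_below m | ~~ covered ss m].
have cU : #|U| = (#|covered_below m| - #|covered_below m.+1|)%N.
  rewrite -(cardsID [set ss | covered ss m] (covered_below m)) covered_belowS.
  set X := (X in (X + _)%N); set Y := (Y in (_ - Y)%N).
  have -> : X = Y by apply: eq_card => ss; rewrite !inE.
  by rewrite addKn; apply: eq_card => ss; rewrite !inE andbC.
pose T : {set {ffun 'I_K -> 'I_n}} := [set t : {ffun 'I_K -> 'I_n} | [forall k, (m <= t k)%N]].
have cT : #|T| = ((n - m) ^ K)%N.
  rewrite -card_ord_ge -[in RHS](card_ord K) -card_ffun_on.
  apply: eq_card => t; rewrite inE; apply/forallP/ffun_onP => h k.
    exact: h.
  exact: h k.
have by_rows ss : ss \in covered_below m ->
    ((n - m).-1 ^ K <= #|[set t in T | switch m t ss \in U]|)%N.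
  move=> ssC.
  (* After the switch, row [k] takes the value [ss k (t k)] at [m], so [t k] only has to avoid the
     preimage of [ss i m]: at most one choice is lost. *)
  pose F k : pred 'I_n :=
    [pred j : 'I_n | (m <= j)%N & (k != i) ==> (ss k j != ss i m)].
  have cF k : ((n - m).-1 <= #|F k|)%N.
    rewrite -card_ord_ge (cardD1 ((ss k)^-1 (ss i m)))%g.
    apply: (@leq_trans #|[predD1 [pred j : 'I_n | (m <= j)%N]
                           & ((ss k)^-1 (ss i m))%g]|).
      by case: (_ \in _) => /=; rewrite ?add1n ?add0n ?leq_pred.
    apply/subset_leq_card/fintype.subsetP => j; rewrite !inE => /andP[jk ->] /=.
    by apply/implyP => _; apply: contraNneq jk => <-; rewrite permK.
  apply: (@leq_trans #|family F|).
    rewrite card_family -[X in (_ ^ X)%N]card_ord -prod_nat_const foldrE big_image.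
    by apply: leq_prod => k _; exact: cF.
  apply/subset_leq_card/fintype.subsetP => t /familyP h.
  have tT k : (m <= t k)%N by have := h k; rewrite inE => /andP[].
  rewrite inE; apply/andP; split; first by rewrite inE; apply/forallP.
  rewrite inE switch_covered_below//=; apply/existsP => -[k /andP[ki]].
  rewrite !ffunE eqxx (negbTE ki) permM tpermL.
  by have := h k; rewrite inE ki /= => /andP[_ /negbTE ->].
have by_cols t : t \in T ->
    (#|[set ss in covered_below m | switch m t ss \in U]| <= #|U|)%N.
  move=> _; rewrite -(card_imset _ (@switch_inj m t)).
  by apply/subset_leq_card/fintype.subsetP => _ /imsetP[ss + ->]; rewrite inE => /andP[].
rewrite -cU -cT mulnC -sum_nat_const -[X in (_ <= X)%N]sum_nat_const.
apply: leq_trans (leq_sum _ by_rows) _.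
apply: leq_trans (leq_sum _ by_cols).
under eq_bigr do rewrite -sum1_card.
under [X in (_ <= X)%N]eq_bigr do rewrite -sum1_card.
rewrite (exchange_big_dep (mem T))//=; last first.
  by move=> ss t _; rewrite inE => /andP[].
apply/eq_leq; apply: eq_bigr => t tT; apply: eq_bigl => ss.
by rewrite [X in _ && X]finset.in_set tT [RHS]finset.in_set.
Qed.

End Covering.

(** * Probability that a witness is missing *)

Section CoveringProbability.
Variables (R : realType) (n K : nat).

(** Each of the first [L] columns multiplies the count by at most [1 - q ^+ K], by [card_uncovered];
    [q] is the worst ratio, as the next-to-last step [qN] shows for every [l < L]. *)
Lemma card_covered_below (i : 'I_K) (L : nat) : (L < n)%N ->
  #|@covered_below n K i L|%:R <=
  (1 - (1 - (n - L)%:R^-1) ^+ K) ^+ L * #|{: {ffun 'I_K -> {perm 'I_n}}}|%:R :> R.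
Proof.
move=> Ln; set q : R := 1 - (n - L)%:R^-1.
have q0 : 0 <= q.
  by rewrite subr_ge0 invf_le1 ?ltr0n ?subn_gt0// ler1n subn_gt0.
have q1 : q <= 1 by rewrite gerBl invr_ge0.
suff h l : (l <= L)%N -> #|@covered_below n K i l|%:R <=
    (1 - q ^+ K) ^+ l * #|{: {ffun 'I_K -> {perm 'I_n}}}|%:R :> R by exact: h.
elim: l => [_|l IH lL]; first by rewrite covered_below0 cardsT expr0 mul1r.
have ln : (l < n)%N by exact: leq_trans lL (ltnW Ln).
have := @card_uncovered n K i (Ordinal ln); rewrite /= -(ler_nat R).
rewrite !natrM !natrX [X in _ <= _ * X]natrB; last first.
  rewrite -[l.+1]/(Ordinal ln).+1 covered_belowS subset_leq_card//.
  by apply/fintype.subsetP => ss; rewrite inE => /andP[].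
set c := #|covered_below n i l|%:R; set c' := (X in _ * (_ - X)) => h.
have N0 : 0 < (n - l)%:R :> R by rewrite ltr0n subn_gt0.
have c0 : 0 <= c by exact: ler0n.
have qN : q <= (n - l).-1%:R / (n - l)%:R.
  rewrite -subn1 natrB ?subn_gt0// mulrBl divff ?gt_eqF// mul1r lerB//.
  by rewrite lef_pV2 ?posrE ?ltr0n ?subn_gt0// ler_nat leq_sub2l// ltnW.
have : q ^+ K * c <= c - c'.
  rewrite -(ler_pM2l (exprn_gt0 K N0)); apply: le_trans _ h.
  rewrite mulrA ler_wpM2r// -exprMn lerXn2r ?nnegrE ?mulr_ge0//.
  by rewrite mulrC -ler_pdivlMr.
rewrite lerBrDr -lerBrDl => h2; apply: le_trans h2 _.
rewrite -[X in X - _]mul1r -mulrBl exprS -mulrA.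
apply: ler_wpM2l; first by rewrite subr_ge0 exprn_ile1.
exact: IH (ltnW lL).
Qed.

Definition has_witnesses (ss : {ffun 'I_K -> {perm 'I_n}}) : bool :=
  [forall i, [exists j, [forall k, (ss k j == ss i j) ==> (k == i)]]].

(** Union bound over [i]: without a witness for [i] every column is covered, in particular the first
    [L]. *)
Lemma card_no_witness (L : nat) : (L < n)%N ->
  #|[set ss | ~~ has_witnesses ss]|%:R <=
  K%:R * (1 - (1 - (n - L)%:R^-1) ^+ K) ^+ L
    * #|{: {ffun 'I_K -> {perm 'I_n}}}|%:R :> R.
Proof.
move=> Ln; apply: (@le_trans _ _ (\sum_(i < K) #|@covered_below n K i L|%:R)).
  rewrite -natr_sum ler_nat.
  apply: (@leq_trans (\sum_(ss | ~~ has_witnesses ss)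
      \sum_(i | ss \in @covered_below n K i L) 1)%N).
    rewrite -sum1_card; under eq_bigl do rewrite inE.
    apply: leq_sum => ss /forallPn[i /existsPn noj].
    rewrite (bigD1 i) ?leq_addr// inE; apply/forallP => j; apply/implyP => _.
    have /forallPn[k] := noj j; rewrite negb_imply => /andP[kj ki].
    by apply/existsP; exists k; rewrite ki.
  rewrite (exchange_big_dep predT)//=; apply: leq_sum => i _.
  by rewrite big_mkcondl -sum1_card; apply: leq_sum => ss _; case: ifP.
apply: (@le_trans _ _ (\sum_(i < K) ((1 - (1 - (n - L)%:R^-1) ^+ K) ^+ L
    * #|{: {ffun 'I_K -> {perm 'I_n}}}|%:R))).
  by apply: ler_sum => i _; exact: card_covered_below.
by rewrite sumr_const card_ord -mulrA mulr_natl.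
Qed.

End CoveringProbability.

(** * Asymptotics *)

Section RecoveryProbability.
Variables (R : realType) (a b : R).
Hypotheses (a0 : 0 < a) (ab : a < b).

Lemma unif_iter_has_witnesses (n K : nat) (ss : {ffun 'I_K -> {perm 'I_n}}) :
  has_witnesses ss ->
  unif_iter a b K (fun ps =>
    (if `[< sf_recovers (model_fun ss ps) >] then 1 else 0))%E = 1%E.
Proof.
move=> /forallP wit.
apply: (@unif_iter_ae _ _ _ ab K (@distinct_subset_sums R)
  (fun ps => (if `[< sf_recovers (model_fun ss ps) >] then 1 else 0)%E) _ _ [::]).
- by move=> s; case: ifP => _; rewrite ?lexx ?lee01.
- exact: distinct_subset_sums_rcons.
- by move=> [|? ?] [|? ?].
- by [].
- move=> s sK ds apos; rewrite asboolT//.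
  apply: (@sf_recovers_model R n K ss (fun k => nth 0 s k)).
  + move=> k; apply: lt_le_trans a0 (apos _ _).
    by rewrite mem_nth// sK ltn_ord.
  + by move=> T T'; apply: distinct_subset_sums_set.
  + move=> k; have /existsP[j /forallP jk] := wit k.
    by exists j => l /eqP e; apply/eqP; exact: implyP (jk l) e.
Qed.

(** Tuples with witnesses contribute their full weight, the others at least 0. *)
Lemma recovery_prob_bounds (n K L : nat) : (L < n)%N ->
  ((1 - K%:R * (1 - (1 - (n - L)%:R^-1) ^+ K) ^+ L)%:E
     <= recovery_prob a b n K <= 1)%E.
Proof.
move=> Ln; rewrite /recovery_prob.
set N : R := #|{: {ffun 'I_K -> {perm 'I_n}}}|%:R.
have N0 : 0 < N by rewrite ltr0n; apply/card_gt0P; exists [ffun=> 1%g].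
have Ni0 : (0 <= N^-1%:E)%E by rewrite lee_fin invr_ge0 ltW.
have u01 (ss : {ffun 'I_K -> {perm 'I_n}}) : (0 <= unif_iter a b K (fun ps =>
    (if `[< sf_recovers (model_fun ss ps) >] then 1 else 0)) <= 1)%E.
  by apply: unif_iter_bounds => // s; case: ifP => _; rewrite ?lexx ?lee01.
apply/andP; split; last first.
  apply: (@le_trans _ _ (\sum_(ss : {ffun 'I_K -> {perm 'I_n}}) N^-1%:E)%E).
    apply: lee_sum => ss _; rewrite -[leRHS]mule1; apply: lee_wpmul2l => //.
    by case/andP: (u01 ss).
  by rewrite sumEFin sumr_const -mulr_natr mulVf// gt_eqF.
apply: (@le_trans _ _ (\sum_(ss : {ffun 'I_K -> {perm 'I_n}})
    (N^-1 * (has_witnesses ss)%:R)%:E)%E); last first.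
  apply: lee_sum => ss _; rewrite EFinM; apply: lee_wpmul2l => //.
  case: (boolP (has_witnesses ss)) => [/unif_iter_has_witnesses -> //|_].
  by case/andP: (u01 ss).
rewrite sumEFin lee_fin -mulr_sumr -natr_sum.
have : (\sum_(ss : {ffun 'I_K -> {perm 'I_n}}) has_witnesses ss)%:R
     + #|[set ss | ~~ @has_witnesses n K ss]|%:R = N.
  rewrite -natrD -sum1_card [X in (_ + X)%N]big_mkcond -big_split /=.
  rewrite /N -sum1_card; congr _%:R; apply: eq_bigr => ss _.
  by rewrite inE; case: has_witnesses.
have := card_no_witness R K Ln; rewrite -/N => bad good.
by rewrite [leRHS]mulrC ler_pdivlMr// mulrBl mul1r; lra.
Qed.

End RecoveryProbability.

(** * Explicit estimate of the failure probability *)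

Section FailureBound.
Variable R : realType.

(* With [L ~ (eps / 4) n] the failure probability is at most
   [K * exp (- L * n ^ (eps / 4 - 1))]. *)
Lemma failure_bound (eps : R) (n K : nat) : 0 < eps <= 1 ->
  K%:R <= (1 - eps) * n%:R * ln (n%:R : R) -> (3 <= n)%N ->
  1 <= eps / 2 * n%:R -> 12 <= (eps / 4) ^+ 3 * ln (n%:R : R) ->
  exists2 L, (L < n)%N &
    K%:R * (1 - (1 - (n - L)%:R^-1) ^+ K) ^+ L <= expR 1 / n%:R :> R.
Proof.
move=> /andP[e0 e1] hK n3 hn; set y := ln _ in hK *; move=> hy.
pose D := eps / 4; have D0 : 0 < D by rewrite divr_gt0.
have D4 : D <= 1 / 4 by rewrite /D; lra.
have n0 : 0 < n%:R :> R by rewrite ltr0n (leq_trans _ n3).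
have n3R : 3 <= n%:R :> R by rewrite (ler_nat R 3).
have ny : n%:R = expR y by rewrite /y lnK.
have y0 : 0 <= y by rewrite ln_ge0//; lra.
pose L := Num.truncn (D * n%:R).
have LDn : L%:R <= D * n%:R.
  by have /truncn_itv/andP[] : 0 <= D * n%:R by rewrite mulr_ge0// ltW.
have DnL : D * n%:R - 1 <= L%:R.
  have := Num.Theory.truncnS_gt (D * n%:R); rewrite -/L -natr1; lra.
have Ln : (L < n)%N by rewrite -(ltr_nat R); nra.
exists L => //.
have Nn : (n - L)%:R = n%:R - L%:R :> R by rewrite natrB// ltnW.
set N : R := (n - L)%:R in Nn *.
have N2 : 2 <= N by rewrite Nn; nra.
(* With [eps = 4 * D] and [N >= (1 - D) * n], this reduces to
   [(1 - 4 * D) * n <= (1 - D) * (N - 1)], where [1 <= 2 * D * n] absorbs the [- 1]. *)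
have rate : K%:R / (N - 1) <= (1 - D) * y.
  rewrite ler_pdivrMr; last lra.
  apply: le_trans hK _; rewrite [leRHS]mulrAC ler_wpM2r//.
  have -> : eps = 4 * D by rewrite /D; field.
  have : 1 <= 2 * D * n%:R by rewrite /D; lra.
  rewrite Nn; nra.
have qK : expR (- ((1 - D) * y)) <= (1 - N^-1) ^+ K.
  apply: (@le_trans _ _ (expR (- (N - 1)^-1) ^+ K)).
    rewrite -expRM_natl ler_expR mulrN lerN2 mulrC; lra.
  rewrite lerXn2r ?nnegrE ?expR_ge0//.
    by rewrite subr_ge0 invf_le1; lra.
  (* This form turns [1 + x <= expR x] into a lower bound on [1 - N^-1]. *)
  have -> : 1 - N^-1 = (1 + (N - 1)^-1)^-1.
    by field; apply/andP; split; lra.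
  by rewrite expRN lef_pV2 ?posrE ?expR_gt0 ?expR_ge1Dx// addr_gt0// invr_gt0; lra.
set Q := (1 - N^-1) ^+ K in qK *.
have Q1 : Q <= 1.
  apply: exprn_ile1; first by rewrite subr_ge0 invf_le1; lra.
  by rewrite gerBl invr_ge0; lra.
(* [L * Q] is at least [D * expR (D * y) - 1]; splitting the exponential into two equal factors,
   each at least [D * y / 2], gives the quadratic bound. *)
have LQ : D ^+ 3 * y ^+ 2 / 4 - 1 <= L%:R * Q.
  apply: (@le_trans _ _ ((D * n%:R - 1) * expR (- ((1 - D) * y)))); last first.
    apply: le_trans (ler_wpM2l (ler0n _ _) qK).
    by rewrite ler_wpM2r// expR_ge0.
  rewrite mulrBl mul1r ny -[D * expR y * _]mulrA -expRD.
  have -> : y + - ((1 - D) * y) = D * y / 2 + D * y / 2 by field.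
  rewrite expRD; have := expR_ge1Dx (D * y / 2).
  have : expR (- ((1 - D) * y)) <= 1.
    by rewrite -[leRHS]expR0 ler_expR oppr_le0 mulr_ge0//; lra.
  have : 0 <= D * y / 2 by rewrite divr_ge0 ?mulr_ge0// ltW.
  set u := expR (- _); set v := expR (D * y / 2) => Dy0 u1 v1.
  have : (D * y / 2) ^+ 2 <= v * v by rewrite expr2 ler_pM//; lra.
  rewrite (_ : D ^+ 3 * y ^+ 2 / 4 = D * (D * y / 2) ^+ 2); last by field.
  by move/(ler_wpM2l (ltW D0)); lra.
have pow : (1 - Q) ^+ L <= expR (1 - D ^+ 3 * y ^+ 2 / 4).
  apply: (@le_trans _ _ (expR (- Q) ^+ L)).
    by rewrite lerXn2r ?nnegrE ?expR_ge0 ?subr_ge0// expR_ge1Dx.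
  by rewrite -expRM_natl ler_expR mulrN; lra.
(* Crude bound [K <= n * ln n <= n ^ 2]. *)
have K2 : K%:R <= expR (2 * y).
  rewrite mulrDl mul1r expRD -ny.
  have : y <= n%:R by rewrite ny; have := expR_ge1Dx y; lra.
  have : (1 - eps) * n%:R <= n%:R by nra.
  have : 0 <= (1 - eps) * n%:R by rewrite mulr_ge0//; lra.
  move=> u0 u1 yn; apply: le_trans hK _; exact: ler_pM.
apply: le_trans (ler_pM _ _ K2 pow) _ => //.
  by rewrite exprn_ge0// subr_ge0.
rewrite -expRD ny -expRN -expRD ler_expR.
have -> : D ^+ 3 * y ^+ 2 / 4 = (D ^+ 3 * y) * y / 4 by field.
(* The exponent is then at most [2 * y + 1 - 3 * y = 1 - y]. *)
have : 12 * y <= (D ^+ 3 * y) * y by rewrite ler_wpM2r.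
lra.
Qed.

End FailureBound.

(** * Convergence of the recovery probability *)

Local Open Scope classical_set_scope.

Theorem theorem3 (R : realType) (a b eps : R) (K : nat -> nat) :
  0 < a -> a < b -> 0 < eps ->
  (forall n : nat, (K n)%:R <= (1 - eps) * n%:R * ln (n%:R : R)) ->
  (fun n : nat => recovery_prob a b n (K n)) @ \oo --> 1%E.
Proof.
move=> a0 ab e0 hK.
(* For [eps > 1] the bound on [K 2] would be negative. *)
have e1 : eps <= 1.
  rewrite leNgt; apply/negP => e1.
  have ln2 : 0 < ln (2 : R) by rewrite ln_gt0// ltr1n.
  have := le_trans (ler0n R (K 2)) (hK 2); nra.
(* The three thresholds yield the three largeness conditions on [n] in [failure_bound]. *)
pose M : R := Num.max 3 (Num.max (2 / eps) (expR (12 / (eps / 4) ^+ 3))).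
apply: (@squeeze_cvge _ _ _ _
  (fun n => (1 - 2 * expR 1 * harmonic n)%:E) _ (fun=> 1%E)).
- near=> n.
  have : M <= n%:R by near: n; exact: nbhs_infty_ger.
  rewrite !ge_max => /and3P[n3 ne nexp].
  have n0 : 0 < n%:R :> R by lra.
  have [L Ln fail] : exists2 L, (L < n)%N &
      (K n)%:R * (1 - (1 - (n - L)%:R^-1) ^+ (K n)) ^+ L <= expR 1 / n%:R :> R.
    apply: (@failure_bound R eps) => //.
    + by rewrite e0.
    + by rewrite -(ler_nat R).
    + by move: ne; rewrite ler_pdivrMr//; lra.
    + have D3 : 0 < (eps / 4) ^+ 3 by rewrite exprn_gt0// divr_gt0.
      rewrite mulrC -ler_pdivrMr// -[leLHS]expRK ler_ln ?posrE ?expR_gt0//.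
  have /andP[lo ->] := recovery_prob_bounds a0 ab (K n) Ln.
  rewrite andbT; apply: le_trans lo; rewrite lee_fin lerB//.
  (* [harmonic n] is [1 / (n + 1)]; the factor 2 covers the shift, as [n + 1 <= 2 * n]. *)
  apply: (le_trans fail); rewrite /harmonic /= [2 * _]mulrC -mulrA.
  rewrite ler_wpM2l ?expR_ge0// ler_pdivlMr ?ltr0n// mulrC ler_pdivrMr//.
  by rewrite -natr1; lra.
- apply: cvg_EFin; first by near=> n.
  rewrite -[X in _ --> X]subr0 -[X in _ --> _ - X](mulr0 (2 * expR 1)).
  apply: cvgB; first exact: cvg_cst.
  by apply: cvgMr; exact: cvg_harmonic.
- exact: cvg_cst.
Unshelve. all: by end_near.
Qed.
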